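(* Let $M$ be an atomized semilattice over a finite set of constants $C=\{c_1,\dots,c_m\}$ and let $t_1,\dots,t_e$ be terms of $F_C(\emptyset)$. Let $G=\{g_1,\dots,g_e\}$ be a set of $e$ new constants, $G\cap C=\emptyset$. Let $S$ be the subalgebra of $M$ generated by (the elements represented by) $t_1,\dots,t_e$, represented using the constants in $G$, i.e. viewed as a model over $G$ in which $g_i$ is interpreted as $\nu_M(t_i)$. Then: (i) $S=\Big(\prod_{i=1}^e\square_{g_i\le t_i}\square_{t_i\le g_i}\,(M+F_G(\emptyset))\Big)^{|G}$, where the product denotes composition of the operators. (ii) For each $k=1,\dots,m$ let $G^k\subseteq G$ be the set such that $g_i\in G^k\Leftrightarrow c_k\in\mathbf{C}(t_i)$. Then $S$ is the renamed model $\big[\tfrac{G^1}{c_1}\tfrac{G^2}{c_2}\cdots\tfrac{G^m}{c_m}\big]M$. (iii) The number of non-redundant atoms of $S$ is less than or equal to the number of non-redundant atoms of $M$.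
   Context: A semilattice is a nonempty set with a commutative, associative, idempotent operation $\odot$, ordered by $a\le b$ iff $a\odot b=b$. For a finite set $C$ of constants, $F_C(\emptyset)$ is the free semilattice on $C$; its elements (terms) $t$ are identified with their nonempty sets $\mathbf{C}(t)\subseteq C$ of component constants. A model over $C$ is a semilattice $M$ with a map $C\to M$ whose image generates $M$; it induces the natural homomorphism $\nu_M:F_C(\emptyset)\to M$. Models over the same constants are regarded as equal if they satisfy the same inequalities between terms. For $Q\subseteq C$, $M^{|Q}$ is the subalgebra of $M$ generated by $Q$, viewed as a model over $Q$. An atom $\phi$ over $C$ is determined by a nonempty subset $\mathbf{U}^c(\phi)\subseteq C$; $\phi<t$ means $\mathbf{C}(t)\cap\mathbf{U}^c(\phi)\ne\emptyset$. A set $A$ of atoms over $C$ atomizes $M$ ($M=[A]$) if every $c\in C$ satisfies $\phi<c$ for some $\phi\in A$, and for all terms $t,s$: $\nu_M(t)\le\nu_M(s)$ iff there is no $\phi\in A$ with $\phi<t$, $\phi\not<s$. An atom is in $M$ if it belongs to some set of atoms atomizing $M$; an atom $\phi$ is redundant with $M$ if for each $c$ with $\phi<c$ there is $\eta$ in $M$ with $\eta<c$ and $\mathbf{U}^c(\eta)\subsetneq\mathbf{U}^c(\phi)$; the non-redundant atoms of $M$ are the atoms in $M$ not redundant with $M$. Union model: if $M=[A]$ over $C$ and $N=[B]$ over $G$, $M+N$ is the model $[A\cup B]$ over $C\cup G$ (independent of the choice of $A,B$). Full crossing: for terms $r_L,r_R$ and a model $K=[A]$, put $H=\{\phi\in A:\phi<r_L,\phi\not<r_R\}$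 and $B=\{\phi\in A:\phi<r_R\}$; $\square_{r_L\le r_R}K$ is the model atomized by $(A\setminus H)\cup\{\lambda\bigtriangledown\rho:\lambda\in H,\rho\in B\}$, where $\mathbf{U}^c(\lambda\bigtriangledown\rho)=\mathbf{U}^c(\lambda)\cup\mathbf{U}^c(\rho)$ (as a model it does not depend on $A$). Rename: $\big[\tfrac{G^1}{c_1}\cdots\tfrac{G^m}{c_m}\big]$ acts on an atom $\phi$ over $C$ by replacing each $c_k\in\mathbf{U}^c(\phi)$ by all the constants in $G^k$, i.e. the new atom over $G$ has upper set $\bigcup_{k:\,c_k\in\mathbf{U}^c(\phi)}G^k$ ($G^k$ may be empty); if this set is empty the atom is removed. The renamed model of $M=[A]$ is the model over $G$ atomized by the renamed atoms of $A$. *)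

(* Defs.v *)
From HB Require Import structures.
From mathcomp Require Export all_boot all_order.

Set Implicit Arguments.
Unset Strict Implicit.
Unset Printing Implicit Defensive.

Import Order.TTheory Order.SetSubsetOrder.Exports.
Local Open Scope order_scope.

(* Constants live in an ambient finite type T, so that unions and subsets of  *)
(* sets of constants make sense: the terms, atoms and models over a set of    *)
(* constants C : {set T} are those over the elements of the type {c | c \in C}. *)

Section Terms.
Variable (T : finType).
Implicit Types (C D Q : {set T}).

(* A term over C is identified with its nonempty set of component constants.  *)
Record term C := Term {
  comps :> {set T};
  termP : (comps != set0) && (comps \subset C) }.

HB.instance Definition _ C := [isSub of term C for @comps C].
HB.instance Definition _ C := [Finite of term C by <:].

Lemma term_ex C (t : term C) : exists c : {c | c \in C}, val c \in comps t.
Proof.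
case: t => t /= /andP[/set0Pn[c ct] /subsetP sub].
by exists (exist _ c (sub _ ct)).
Qed.

Fact term_join_subproof C (t s : term C) :
  (comps t :|: comps s != set0) && (comps t :|: comps s \subset C).
Proof.
case: t s => t /= /andP[t0 tC] [s /= /andP[_ sC]].
by rewrite subUset tC sC setU_eq0 negb_and t0.
Qed.
Definition term_join C (t s : term C) : term C := Term (term_join_subproof t s).

Fact term_const_subproof C (c : {c | c \in C}) :
  ([set val c] != set0) && ([set val c] \subset C).
Proof. by rewrite -card_gt0 cards1 sub1set (valP c). Qed.
Definition term_const C (c : {c | c \in C}) : term C :=
  Term (term_const_subproof c).

(* The free semilattice on C is term C, with union of components as join.     *)
Fact term_display : Order.disp_t. Proof. exact: (Order.Disp tt tt). Qed.

Fact term_le_refl C : reflexive (fun t s : term C => comps t \subset comps s).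
Proof. by move=> t /=. Qed.
Fact term_le_anti C :
  antisymmetric (fun t s : term C => comps t \subset comps s).
Proof. by move=> t s ts; apply/val_inj/eqP; rewrite eqEsubset. Qed.
Fact term_le_trans C :
  transitive (fun t s : term C => comps t \subset comps s).
Proof. by move=> t s u; apply: subset_trans. Qed.
HB.instance Definition _ C := Order.Le_isPOrder.Build term_display (term C)
  (@term_le_refl C) (@term_le_anti C) (@term_le_trans C).

Fact term_leUx C (t s u : term C) : (term_join t s <= u) = (t <= u) && (s <= u).
Proof. exact: subUset. Qed.
HB.instance Definition _ C := Order.POrder_isJoinSemilattice.Build
  term_display (term C) (@term_leUx C).

End Terms.

Section Models.
Variable (T : finType).
Implicit Types (C D Q : {set T}).

Inductive generated d (L : joinSemilatticeType d) (I : Type) (a : I -> L) :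
    L -> Prop :=
  | generated_in i : generated a (a i)
  | generated_join x y :
      generated a x -> generated a y -> generated a (x `|` y).

(* Since the constants generate it, the carrier is nonempty iff C is.         *)
Record model C := Model {
  model_disp : Order.disp_t;
  carrier :> joinSemilatticeType model_disp;
  interp : {c | c \in C} -> carrier;
  _ : forall x, generated interp x }.

(* The join of the a c for c in t. Semilattices have no bottom: the big       *)
(* operator starts from a c0 with c0 in t, and c0 being joined again is       *)
(* harmless.                                                                  *)
Definition eval d (L : joinSemilatticeType d) C (a : {c | c \in C} -> L)
    (t : term C) : L :=
  let c0 := xchoose (term_ex t) in
  \big[Order.join/a c0]_(c : {c | c \in C} | val c \in comps t) a c.

Definition nu C (M : model C) (t : term C) : M := eval (@interp C M) t.

Definition model_eq C (M N : model C) : Prop :=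
  forall t s : term C, (nu M t <= nu M s) = (nu N t <= nu N s).

Section Eval.
Context d (L : joinSemilatticeType d) C (a : {c | c \in C} -> L).

Lemma eval_le t y :
  (eval a t <= y) = [forall c, (val c \in comps t) ==> (a c <= y)].
Proof.
have bigle (r : seq {c | c \in C}) x0 :
    (\big[Order.join/x0]_(c <- r | val c \in comps t) a c <= y) =
    (x0 <= y) && all (fun c => (val c \in comps t) ==> (a c <= y)) r.
  elim: r => [|c r IH]; first by rewrite big_nil andbT.
  rewrite big_cons /=; case: ifP => _ /=; last exact: IH.
  by rewrite leUx IH andbCA.
rewrite /eval bigle; apply/andP/forallP => [[_ /allP h] c|h].
  by apply: h; rewrite mem_index_enum.
split; last by apply/allP.
exact: implyP (h _) (xchooseP (term_ex t)).
Qed.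

Lemma eval_join t s : eval a (term_join t s) = eval a t `|` eval a s.
Proof.
have ext y : (eval a (term_join t s) <= y) = (eval a t `|` eval a s <= y).
  rewrite leUx !eval_le; apply/forallP/andP => [h|[/forallP h1 /forallP h2] c].
    split; apply/forallP => c; apply/implyP => cts; apply: (implyP (h c));
      by rewrite inE cts ?orbT.
  by rewrite inE; apply/implyP => /orP[]; [exact/implyP | exact/implyP].
by apply/le_anti; rewrite ext lexx -ext lexx.
Qed.

Lemma eval_const c : eval a (term_const c) = a c.
Proof.
apply/le_anti/andP; split.
  rewrite eval_le; apply/forallP => c'; apply/implyP => /set1P /val_inj ->.
  exact: lexx.
have := lexx (eval a (term_const c)); rewrite eval_le => /forallP /(_ c).
by rewrite set11.
Qed.

Lemma generatedP x : reflect (generated a x) [exists t, eval a t == x].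
Proof.
apply: (iffP existsP) => [[t /eqP <-]|].
  rewrite /eval; elim/big_rec: _ => [|c y _ gy]; first exact: generated_in.
  by apply: generated_join => //; apply: generated_in.
elim=> [c|y z _ [t /eqP <-] _ [s /eqP <-]].
  by exists (term_const c); rewrite eval_const.
by exists (term_join t s); rewrite eval_join.
Qed.

(* The subalgebra of L generated by the a c. The membership test is the       *)
(* decidable form of "generated a", by generatedP.                            *)
Record subalgebra := Subalgebra {
  subalgebra_val : L;
  subalgebraP : [exists t, eval a t == subalgebra_val] }.
HB.instance Definition _ := [isSub of subalgebra for subalgebra_val].
HB.instance Definition _ := [Choice of subalgebra by <:].
HB.instance Definition _ := [SubChoice_isSubPOrder of subalgebra by <:
  with d].

Fact subalgebra_join_subproof (x y : subalgebra) :
  [exists t, eval a t == val x `|` val y].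
Proof.
by apply/generatedP/generated_join; apply/generatedP/subalgebraP.
Qed.
Definition subalgebra_join (x y : subalgebra) :=
  Subalgebra (subalgebra_join_subproof x y).
Fact subalgebra_leUx x y z :
  (subalgebra_join x y <= z) = (x <= z) && (y <= z).
Proof. by rewrite -!Order.le_val /= leUx. Qed.
HB.instance Definition _ := Order.POrder_isJoinSemilattice.Build
  d subalgebra subalgebra_leUx.

Fact subalgebra_in_subproof c : [exists t, eval a t == a c].
Proof. exact/generatedP/generated_in. Qed.
Definition subalgebra_in c : subalgebra := Subalgebra (subalgebra_in_subproof c).

Fact subalgebra_generated x : generated subalgebra_in x.
Proof.
case: x => x xP; have /generatedP gx := xP; elim: gx xP => [c|y z gy IHy gz IHz] xP.
  by rewrite (_ : Subalgebra _ = subalgebra_in c); [exact: generated_in|exact/val_inj].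
have yP : [exists t, eval a t == y] by apply/generatedP.
have zP : [exists t, eval a t == z] by apply/generatedP.
rewrite (_ : Subalgebra _ = Subalgebra yP `|` Subalgebra zP); last exact/val_inj.
exact: generated_join (IHy _) (IHz _).
Qed.

(* The subalgebra generated by the a c, as a model over C in which each       *)
(* constant c is interpreted as a c.                                          *)
Definition submodel : model C := Model subalgebra_generated.

Lemma val_nu_submodel t : val (nu submodel t : subalgebra) = eval a t.
Proof.
rewrite /nu /eval /=.
by elim/big_rec2: _ => //= c x y _ <-.
Qed.

Lemma nu_submodel_le t s :
  (nu submodel t <= nu submodel s) = (eval a t <= eval a s).
Proof. by rewrite -!val_nu_submodel Order.le_val. Qed.
End Eval.

Fact free_generated C (t : term C) : generated (@term_const T C) t.
Proof.
apply/generatedP/existsP; exists t; apply/eqP/le_anti/andP; split.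
  by rewrite eval_le; apply/forallP => c; rewrite -sub1set; apply/implyP.
apply/subsetP => c ct.
have cC : c \in C by case/andP: (termP t) => _ /subsetP; apply.
have := lexx (eval (@term_const T C) t); rewrite eval_le.
by move=> /forallP /(_ (exist _ c cC)) /implyP /(_ ct) /subsetP; apply; rewrite set11.
Qed.
Definition free_model C : model C := Model (@free_generated C).

Lemma nu_free_model C t : nu (free_model C) t = t.
Proof.
apply/le_anti/andP; split.
  rewrite /nu eval_le; apply/forallP => c; apply/implyP => ct.
  by rewrite [leLHS](_ : _ = term_const c) // /Order.le /= sub1set.
apply/subsetP => c ct.
have cC : c \in C by case/andP: (termP t) => _ /subsetP; apply.
have := lexx (nu (free_model C) t); rewrite {1}/nu eval_le.
by move=> /forallP /(_ (exist _ c cC)) /implyP /(_ ct) /subsetP; apply; rewrite set11.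
Qed.

Definition widen_const Q C (sQC : Q \subset C) (q : {c | c \in Q}) :
  {c | c \in C} := exist _ (val q) (subsetP sQC _ (valP q)).

Definition restrict Q C (sQC : Q \subset C) (M : model C) : model Q :=
  submodel (fun q => @interp C M (widen_const sQC q)).

(* An atom over C is identified with its upper set, a nonempty subset of C,   *)
(* so that it is also an atom over any larger set of constants.               *)
Definition atoms C : {set {set T}} :=
  [set phi : {set T} | (phi != set0) && (phi \subset C)].

(* phi < t, for t a set of component constants; in particular, phi < c means  *)
(* c \in phi.                                                                 *)
Definition atom_lt (phi t : {set T}) : bool := phi :&: t != set0.

Definition covers (A : {set {set T}}) C : bool :=
  [forall c in C, [exists phi in A, c \in phi]].

Definition discriminates (A : {set {set T}}) (t s : {set T}) : bool :=
  [exists phi in A, atom_lt phi t && ~~ atom_lt phi s].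

Definition atomizes C (A : {set {set T}}) (M : model C) : bool :=
  [&& A \subset atoms C, covers A C &
      [forall t : term C, forall s : term C,
         (nu M t <= nu M s) == ~~ discriminates A t s]].

Definition atoms_in C (M : model C) : {set {set T}} :=
  [set phi | [exists A : {set {set T}}, atomizes A M && (phi \in A)]].

Definition redundant C (M : model C) (phi : {set T}) : bool :=
  [forall c in phi, [exists eta in atoms_in M, (c \in eta) && (eta \proper phi)]].

Definition nonredundant_atoms C (M : model C) : {set {set T}} :=
  [set phi in atoms_in M | ~~ redundant M phi].

(* The sets over a finite type, ordered by inclusion, with join :|:.         *)
Local Notation setsem X :=
  (Order.SetSubsetOrder.type Order.SetSubsetOrder.subset_display X).

(* The model [A] over C: a constant c is interpreted as the set of the atoms  *)
(* phi of A with phi < c, in the semilattice of sets of atoms under union.    *)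
(* See model_ofP.                                                             *)
Definition atoms_below C (A : {set {set T}}) (c : {c | c \in C}) :
    setsem {set T} :=
  [set phi in A | val c \in phi].

Definition model_of C (A : {set {set T}}) : model C :=
  submodel (@atoms_below C A).

Lemma nu_model_of_le C (A : {set {set T}}) (t s : term C) :
  (nu (model_of C A) t <= nu (model_of C A) s) = ~~ discriminates A t s.
Proof.
rewrite nu_submodel_le; set a := @atoms_below C A.
have memE (u : term C) phi :
    phi \in (eval a u : {set {set T}}) = (phi \in A) && atom_lt phi u.
  apply/idP/idP.
    have : eval a u <= ([set psi in A | atom_lt psi u] : setsem _).
      rewrite eval_le; apply/forallP => c; apply/implyP => cu.
      apply/subsetP => psi; rewrite !inE => /andP[-> cpsi] /=.
      by apply/set0Pn; exists (val c); rewrite inE cpsi.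
    by move/subsetP => sub /sub; rewrite inE.
  case/andP=> phiA /set0Pn[c]; rewrite inE => /andP[cphi cu].
  have cC : c \in C by case/andP: (termP u) => _ /subsetP; apply.
  have := lexx (eval a u); rewrite eval_le.
  move=> /forallP /(_ (exist _ c cC)) /implyP /(_ cu) /subsetP; apply.
  by rewrite !inE phiA.
apply/subsetP/existsPn => [sub phi|nd phi].
  have := sub phi; rewrite !memE.
  by case: (phi \in A) => //=; case: (atom_lt phi t) => //= ->.
rewrite !memE; have := nd phi.
by case: (phi \in A) => //=; case: (atom_lt phi t) => //=; rewrite negbK.
Qed.

Lemma model_ofP C (A : {set {set T}}) :
  A \subset atoms C -> covers A C -> atomizes A (model_of C A).
Proof.
move=> sA cA; apply/and3P; split=> //.
by apply/forallP => t; apply/forallP => s; rewrite nu_model_of_le.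
Qed.

Lemma atomizable C (M : model C) : exists A : {set {set T}}, atomizes A M.
Proof.
pose up (s : term C) : {set T} :=
  [set val c | c in [pred c | ~~ (@interp C M c <= nu M s)]].
have upP s (c : {c | c \in C}) :
    (val c \in up s) = ~~ (@interp C M c <= nu M s).
  by rewrite mem_imset //; exact: val_inj.
have up_lt (t s : term C) : atom_lt (up s) t = ~~ (nu M t <= nu M s).
  rewrite [in RHS]/nu eval_le negb_forall; apply/set0Pn/existsP.
    case=> x; rewrite inE => /andP[/imsetP[c cs ->] ct].
    by exists c; rewrite negb_imply ct.
  case=> c; rewrite negb_imply => /andP[ct cs].
  by exists (val c); rewrite inE upP cs.
have up_sub s : up s \subset C by apply/subsetP => x /imsetP[c _ ->]; apply: valP.
exists ((C |: [set up s | s : term C]) :\ set0); apply/and3P; split.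
- apply/subsetP => phi; rewrite !inE => /andP[-> /orP[/eqP->|/imsetP[s _ ->]]] //=.
- apply/forallP => c; apply/implyP => cC; apply/existsP; exists C.
  rewrite cC andbT in_setD1 setU11 andbT; by apply/set0Pn; exists c.
apply/forallP => t; apply/forallP => s; apply/eqP; apply/idP/existsPn.
  move=> ts phi; rewrite !inE; apply/negP => /andP[/andP[phi0]].
  case/orP=> [/eqP->|/imsetP[u _ ->]].
    case/andP=> _ /negP; apply; case/andP: (termP s) => s0 /setIidPr sC.
    by rewrite /atom_lt sC.
  by rewrite !up_lt negbK => /andP[/negP tu su]; apply/tu/(le_trans ts su).
move=> nd; apply/negPn; rewrite -up_lt; have := nd (up s).
rewrite !inE imset_f // orbT andbT !up_lt lexx andbT; apply: contra => h.
rewrite h andbT; have : atom_lt (up s) t by rewrite up_lt.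
by apply: contraTneq => ->; rewrite /atom_lt set0I eqxx.
Qed.

Lemma atoms_in_atomizes C (M : model C) : atomizes (atoms_in M) M.
Proof.
have [A0 A0M] := atomizable M; have sub (A : {set {set T}}) : atomizes A M -> A \subset atoms_in M.
  move=> AM; apply/subsetP => phi phiA; rewrite inE.
  by apply/existsP; exists A; rewrite AM.
apply/and3P; split.
- apply/subsetP => phi; rewrite inE => /existsP[A /andP[/and3P[/subsetP sA _ _]]].
  exact: sA.
- apply/forallP => c; apply/implyP => cC; case/and3P: (A0M) => _ /forallP cov _.
  have /existsP[phi /andP[phiA cphi]] := implyP (cov c) cC.
  by apply/existsP; exists phi; rewrite (subsetP (sub _ A0M)).
apply/forallP => t; apply/forallP => s; apply/eqP/esym; apply/idP/idP.
  apply: contraR; case/and3P: (A0M) => _ _ /forallP/(_ t)/forallP/(_ s)/eqP->.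
  rewrite negbK => /existsP[phi /andP[phiA h]].
  by apply/existsP; exists phi; rewrite (subsetP (sub _ A0M)).
move=> ts; apply/existsPn => phi; rewrite inE; apply/negP => /andP[/existsP[A]].
case/andP=> /and3P[_ _ /forallP/(_ t)/forallP/(_ s)]; rewrite ts eq_sym => /eqP.
by move=> /existsPn /(_ phi) + phiA; rewrite phiA /= => /negP.
Qed.

(* M + N, full crossing and rename of models use the set of all atoms in the  *)
(* model as atomization; that any other choice gives the same model is        *)
(* unionP, crossingP and renameP below.                                       *)
Definition union_model C D (M : model C) (N : model D) : model (C :|: D) :=
  model_of (C :|: D) (atoms_in M :|: atoms_in N).

Definition crossing_atoms (rL rR : {set T}) (A : {set {set T}}) :=
  let H := [set phi in A | atom_lt phi rL && ~~ atom_lt phi rR] in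
  let B := [set phi in A | atom_lt phi rR] in
  (A :\: H) :|: [set lambda :|: rho | lambda in H, rho in B].

Definition crossing C (rL rR : {set T}) (K : model C) : model C :=
  model_of C (crossing_atoms rL rR (atoms_in K)).

Definition rename_atoms m (c : 'I_m -> T) (Gk : 'I_m -> {set T})
    (A : {set {set T}}) : {set {set T}} :=
  [set \bigcup_(k | c k \in phi) Gk k | phi : {set T} in A] :\ set0.

Definition rename m (c : 'I_m -> T) (Gk : 'I_m -> {set T}) (G : {set T})
    C (M : model C) : model G :=
  model_of G (rename_atoms c Gk (atoms_in M)).

(* Two atomizations of the same model refine each other: atomizes_refines.    *)
Definition refines (A A' : {set {set T}}) : Prop := forall (phi : {set T}) c,
  phi \in A -> c \in phi -> exists2 psi : {set T}, psi \in A' & (c \in psi) && (psi \subset phi).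

Lemma atomizes_refines C (M : model C) (A A' : {set {set T}}) :
  atomizes A M -> atomizes A' M -> refines A A'.
Proof.
case/and3P=> /subsetP sA _ hA /and3P[/subsetP sA' /forallP cov' hA'] phi c phiA cphi.
have := sA _ phiA; rewrite inE => /andP[phi0 /subsetP phiC]; have cC := phiC _ cphi.
have [e|ne] := eqVneq (C :\: phi) set0.
  have /existsP[psi /andP[psiA cpsi]] := implyP (cov' c) cC.
  exists psi => //; rewrite cpsi /=.
  have := sA' _ psiA; rewrite inE => /andP[_ psiC]; apply: subset_trans psiC _.
  by rewrite -setD_eq0 e.
have sP : (C :\: phi != set0) && (C :\: phi \subset C) by rewrite ne subsetDl.
pose s := Term sP; pose t := term_const (exist (fun c => c \in C) c cC).
have nle : ~~ (nu M t <= nu M s).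
  move/forallP/(_ t)/forallP/(_ s)/eqP: hA => ->; rewrite negbK.
  apply/existsP; exists phi; rewrite phiA /atom_lt /=; apply/andP; split.
    by apply/set0Pn; exists c; rewrite inE cphi set11.
  by rewrite negbK setIDA setIC -setIDA setDv setI0.
move/forallP/(_ t)/forallP/(_ s)/eqP: hA' nle => ->; rewrite negbK.
case/existsP=> psi /andP[psiA /andP[/set0Pn[x]]]; rewrite inE => /andP[xpsi].
move=> /set1P xc; rewrite xc in xpsi.
rewrite /atom_lt negbK => /eqP psis; exists psi; rewrite // xpsi /=.
have := sA' _ psiA; rewrite inE => /andP[_ /subsetP psiC].
apply/subsetP => y ypsi; have : y \notin psi :&: s by rewrite psis inE.
by rewrite !inE ypsi psiC //= andbT negbK.
Qed.

Lemma refines_discriminates A A' (t s : {set T}) :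
  refines A A' -> discriminates A t s -> discriminates A' t s.
Proof.
move=> r /existsP[phi /andP[phiA /andP[/set0Pn[c]]]]; rewrite inE => /andP[cphi ct].
have [psi psiA /andP[cpsi sub]] := r _ _ phiA cphi.
rewrite negbK => phis; apply/existsP; exists psi; rewrite psiA /=; apply/andP; split.
  by apply/set0Pn; exists c; rewrite inE cpsi.
by rewrite negbK -subset0 -(eqP phis); apply: setSI.
Qed.

Lemma model_of_refines C (A A' : {set {set T}}) : A' \subset atoms C -> covers A' C ->
  refines A A' -> refines A' A -> atomizes A' (model_of C A).
Proof.
move=> sA' cA' r r'; apply/and3P; split=> //.
apply/forallP => t; apply/forallP => s; rewrite nu_model_of_le; apply/eqP.
by congr (~~ _); apply/idP/idP; apply: refines_discriminates.
Qed.

Lemma unionP C D (M : model C) (N : model D) (A B : {set {set T}}) :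
  atomizes A M -> atomizes B N -> atomizes (A :|: B) (union_model M N).
Proof.
have refU (A1 A2 B1 B2 : {set {set T}}) : refines A1 A2 -> refines B1 B2 ->
    refines (A1 :|: B1) (A2 :|: B2).
  move=> rA rB phi c; rewrite inE => /orP[h|h] cphi.
    by have [psi psiA ?] := rA _ _ h cphi; exists psi; rewrite // inE psiA.
  by have [psi psiA ?] := rB _ _ h cphi; exists psi; rewrite // inE psiA orbT.
move=> AM BN; have A'M := atoms_in_atomizes M; have B'N := atoms_in_atomizes N.
apply: model_of_refines; last 2 first.
- by apply: refU; [exact: atomizes_refines A'M AM | exact: atomizes_refines B'N BN].
- by apply: refU; [exact: atomizes_refines AM A'M | exact: atomizes_refines BN B'N].
- case/and3P: AM BN => /subsetP sA _ _ /and3P[/subsetP sB _ _].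
  apply/subsetP => phi; rewrite in_setU => /orP[/sA|/sB]; rewrite !inE => /andP[->] /=.
    by move/subset_trans; apply; apply: subsetUl.
  by move/subset_trans; apply; apply: subsetUr.
case/and3P: AM BN => _ /forallP cA _ /and3P[_ /forallP cB _].
apply/forallP => c; apply/implyP; rewrite inE => /orP[/(implyP (cA c))|/(implyP (cB c))];
  by case/existsP=> phi /andP[h cphi]; apply/existsP; exists phi; rewrite inE h ?orbT.
Qed.

Lemma crossing_refines (rL rR : {set T}) A A' : refines A A' -> 
  refines (crossing_atoms rL rR A) (crossing_atoms rL rR A').
Proof.
move=> r.
have key (chi psi : {set T}) c (rho : {set T}) : psi \in A' -> c \in psi -> psi \subset chi ->
    rho \in A -> atom_lt rho rR -> rho \subset chi ->
    exists2 psi : {set T}, psi \in crossing_atoms rL rR A' & (c \in psi) && (psi \subset chi).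
  move=> psiA cpsi sub rhoA /set0Pn[d]; rewrite inE => /andP[drho dR] rhochi.
  have [psi' psi'A /andP[dpsi' sub']] := r _ _ rhoA drho.
  have [h|h] := boolP (atom_lt psi rL && ~~ atom_lt psi rR); last first.
    by exists psi; rewrite ?cpsi // !inE psiA /= h.
  exists (psi :|: psi'); last first.
    by rewrite in_setU cpsi subUset sub (subset_trans sub').
  rewrite inE; apply/orP; right; apply/imset2P; exists psi psi' => //.
    by rewrite inE psiA.
  by rewrite inE psi'A /=; apply/set0Pn; exists d; rewrite inE dpsi'.
move=> phi c; rewrite inE => /orP[|/imset2P[lam rho]].
  rewrite !inE => /andP[+ phiA] cphi; rewrite phiA /= negb_and negbK.
  have [psi psiA /andP[cpsi sub]] := r _ _ phiA cphi.
  have [phiR _|nR] := boolP (atom_lt phi rR); first exact: (key _ psi c phi).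
  rewrite orbF => nL; exists psi; last by rewrite cpsi.
  rewrite !inE psiA /= andbT negb_and; apply/orP; left; apply/orP; left.
  by apply: contra nL => /set0Pn[x]; rewrite inE => /andP[xp xL];
    apply/set0Pn; exists x; rewrite inE xL (subsetP sub).
rewrite !inE => /andP[lamA /andP[lamL lamR]] /andP[rhoA rhoR] ->.
rewrite inE => /orP[clam|crho].
  have [psi psiA /andP[cpsi sub]] := r _ _ lamA clam.
  by apply: (key _ psi c rho); rewrite ?subsetUr // (subset_trans sub) ?subsetUl.
have [psi psiA /andP[cpsi sub]] := r _ _ rhoA crho.
by apply: (key _ psi c rho); rewrite ?subsetUr // (subset_trans sub) ?subsetUr.
Qed.

Lemma crossingP C (rL rR : term C) (K : model C) (A : {set {set T}}) :
  atomizes A K -> atomizes (crossing_atoms rL rR A) (crossing rL rR K).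
Proof.
move=> AK; have A'K := atoms_in_atomizes K; apply: model_of_refines.
- case/and3P: AK => /subsetP sA _ _; apply/subsetP => phi.
  rewrite inE => /orP[|/imset2P[lam rho]].
    by rewrite inE => /andP[_ /sA].
  rewrite !inE => /andP[/sA + _] /andP[/sA + _] ->.
  by rewrite !inE subUset setU_eq0 negb_and => /andP[-> ->] /andP[_ ->].
- case/and3P: AK => _ /forallP cA _; apply/forallP => c; apply/implyP => cC.
  have /existsP[phi /andP[phiA cphi]] := implyP (cA c) cC; apply/existsP.
  have [h|h] := boolP (atom_lt phi rL && ~~ atom_lt phi rR); last first.
    by exists phi; rewrite cphi !inE phiA /= h.
  have [d dR] := term_ex rR.
  have /existsP[psi /andP[psiA dpsi]] := implyP (cA (val d)) (valP d).
  exists (phi :|: psi); rewrite inE [c \in _]inE cphi andbT; apply/orP; right.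
  apply/imset2P; exists phi psi; rewrite ?inE ?phiA ?psiA //=.
  by apply/set0Pn; exists (val d); rewrite inE dpsi.
- by apply: crossing_refines; apply: atomizes_refines A'K AK.
- by apply: crossing_refines; apply: atomizes_refines AK A'K.
Qed.

Lemma rename_refines m (c : 'I_m -> T) Gk A A' : refines A A' ->
  refines (rename_atoms c Gk A) (rename_atoms c Gk A').
Proof.
move=> r phi x; rewrite !inE => /andP[_ /imsetP[chi chiA ->]] /bigcupP[k ck xk].
have [psi psiA /andP[cpsi sub]] := r _ _ chiA ck.
have xpsi : x \in \bigcup_(k | c k \in psi) Gk k by apply/bigcupP; exists k.
exists (\bigcup_(k | c k \in psi) Gk k).
  rewrite !inE imset_f // andbT; by apply/set0Pn; exists x.
rewrite xpsi /=; apply/bigcupsP => j cj; apply: bigcup_sup.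
exact: (subsetP sub).
Qed.

Lemma renameP m (c : 'I_m -> T) (Gk : 'I_m -> {set T}) C G (M : model C) (A : {set {set T}}) :
  (forall k, c k \in C) -> \bigcup_k Gk k = G ->
  atomizes A M -> atomizes (rename_atoms c Gk A) (rename c Gk G M).
Proof.
move=> cC <- AM; have A'M := atoms_in_atomizes M; apply: model_of_refines.
- apply/subsetP => phi; rewrite !inE => /andP[-> /imsetP[psi _ ->]] /=.
  by apply/bigcupsP => k _; apply: bigcup_sup.
- apply/forallP => x; apply/implyP => /bigcupP[k _ xk]; case/and3P: AM => _ /forallP cA _.
  have /existsP[phi /andP[phiA ckphi]] := implyP (cA (c k)) (cC k); apply/existsP.
  have xphi : x \in \bigcup_(k | c k \in phi) Gk k by apply/bigcupP; exists k.
  exists (\bigcup_(k | c k \in phi) Gk k); rewrite xphi !inE imset_f // !andbT.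
  by apply/set0Pn; exists x.
- by apply: rename_refines; apply: atomizes_refines A'M AM.
- by apply: rename_refines; apply: atomizes_refines AM A'M.
Qed.

End Models.

(* Main.v *)
Require Import Defs.

Set Implicit Arguments.
Unset Strict Implicit.
Unset Printing Implicit Defensive.

(* A model is determined by the set of all the atoms in it. Substituting t i  *)
(* for g i turns a term u over G into a term over C, and u <= v holds in S    *)
(* iff the substituted inequality holds in M. The renaming sends an atom phi  *)
(* of M to the set of the g i with phi < t i, which is below u iff phi is     *)
(* below the substituted u; this gives (ii). The atoms in the crossed model   *)
(* are those of the union that contain g i exactly when they are below t i,   *)
(* so those that meet G extend the atoms in M in the same way; this gives     *)
(* (i). Finally the non-redundant atoms of a model atomize it and belong to   *)
(* all of its atomizations, so those of S are among the renamed non-redundant *)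
(* atoms of M.                                                                *)

(** The working tool is refinement. If [A] atomizes [M], a nonempty [phi] inside [C] is an atom in
    [M] exactly when every constant of [phi] lies in some atom of [A] contained in [phi]
    ([atomizes_refines], [refines_atoms_in]). This yields the exact sets of atoms in
    [in_atoms_crossing] and [in_atoms_union_free]. Inequalities in [S], in the renamed model and in
    the restricted crossings are then each reduced to the inequality between [subst_term u] and
    [subst_term v] in [M], by [nu_subst], [nu_rename_le] and [nu_crossings_le]. The count rests on
    [nonredundant_atomizes] and [nonredundant_sub]. *)

Section Atoms.
Import Order.TTheory.
Local Open Scope order_scope.
Variable T : finType.
Implicit Types (C D G Q phi psi : {set T}) (A : {set {set T}}).

(** * Refinement and the atoms in a model *)

Lemma atom_ltP phi (t : {set T}) :
  reflect (exists2 x, x \in phi & x \in t) (atom_lt phi t).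
Proof.
apply: (iffP (set0Pn _)) => [[x /setIP[]]|[x xphi xt]]; first by exists x.
by exists x; rewrite inE xphi.
Qed.

Lemma atom_lt1 phi x : atom_lt phi [set x] = (x \in phi).
Proof.
by apply/atom_ltP/idP => [[y yphi /set1P <-]|]; last by exists x; rewrite ?set11.
Qed.

Lemma atom_lt_sub phi psi (t : {set T}) :
  phi \subset psi -> atom_lt phi t -> atom_lt psi t.
Proof.
by move=> /subsetP sub /atom_ltP[x /sub xpsi xt]; apply/atom_ltP; exists x.
Qed.

Lemma discriminatesP A (t s : {set T}) :
  reflect (exists phi, [/\ phi \in A, atom_lt phi t & ~~ atom_lt phi s])
    (discriminates A t s).
Proof.
apply: (iffP existsP) => [[phi /and3P[? ? ?]]|[phi [? ? ?]]]; exists phi => //.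
by apply/and3P.
Qed.

Lemma atomizes_le C (M : model C) A (t s : term C) :
  atomizes A M -> (nu M t <= nu M s) = ~~ discriminates A t s.
Proof. by case/and3P=> _ _ /forallP/(_ t)/forallP/(_ s)/eqP. Qed.

Lemma atomizes_eq C (M N : model C) A :
  model_eq M N -> atomizes A N -> atomizes A M.
Proof.
move=> MN AN; case/and3P: (AN) => sA cA _; apply/and3P; split=> //.
by apply/forallP => t; apply/forallP => s; rewrite MN (atomizes_le _ _ AN).
Qed.

Lemma atomizes_sub C (M : model C) A : atomizes A M -> A \subset atoms_in M.
Proof.
by move=> AM; apply/subsetP => phi ?; rewrite inE; apply/existsP; exists A; rewrite AM.
Qed.

Lemma atoms_in_sub C (M : model C) phi :
  phi \in atoms_in M -> phi != set0 /\ phi \subset C.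
Proof.
case/and3P: (atoms_in_atomizes M) => /subsetP sub _ _ /sub.
by rewrite inE => /andP[].
Qed.

(** Any inequality that [phi] violates is already violated by an atom of [A], so adding [phi] to [A]
    gives another atomization of [M]. This is the converse of [atomizes_refines]. *)
Lemma refines_atoms_in C (M : model C) A phi : atomizes A M ->
  phi != set0 -> phi \subset C -> refines [set phi] A -> phi \in atoms_in M.
Proof.
move=> AM phi0 phiC r; suff h : atomizes (phi |: A) M.
  exact: (subsetP (atomizes_sub h)) (setU11 _ _).
have r1 : refines A (phi |: A).
  by move=> psi x psiA xpsi; exists psi; rewrite ?xpsi ?subxx // setU1r.
have r2 : refines (phi |: A) A.
  move=> psi x /setU1P[->|psiA] xpsi; first exact: r (set11 _) xpsi.
  by exists psi; rewrite ?xpsi ?subxx.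
case/and3P: (AM) => sA /forallP cA _; apply/and3P; split.
- by rewrite subUset sA sub1set inE phi0 phiC.
- apply/forallP => x; apply/implyP => /(implyP (cA x))/existsP[psi /andP[psiA xpsi]].
  by apply/existsP; exists psi; rewrite setU1r.
apply/forallP => t; apply/forallP => s; rewrite (atomizes_le _ _ AM).
by apply/eqP; congr (~~ _); apply/idP/idP; apply: refines_discriminates.
Qed.

(** * Atoms in free, crossed and union models *)

Lemma atoms_in_free G : atoms_in (free_model G) = atoms G.
Proof.
apply/setP => phi; rewrite [RHS]inE; apply/idP/andP; first exact: atoms_in_sub.
case=> phi0 phiG; suff h : atomizes (atoms G) (free_model G).
  by apply: (subsetP (atomizes_sub h)); rewrite inE phi0.
apply/and3P; split=> //.
  apply/forallP => x; apply/implyP => xG; apply/existsP; exists [set x].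
  by rewrite !inE -card_gt0 cards1 sub1set xG eqxx.
apply/forallP => t; apply/forallP => s; rewrite !nu_free_model.
apply/eqP; rewrite [t <= s](_ : _ = (comps t \subset comps s)) //.
apply/subsetP/idP => [ts|].
  apply/discriminatesP => -[psi [_ /atom_ltP[x xpsi /ts xs] /atom_ltP[]]].
  by exists x.
(* The singleton of a constant of [t] outside [s] is an atom that separates the two terms. *)
move/discriminatesP => nd x xt; apply: contra_notT nd => xs; exists [set x].
have xG : x \in G by case/andP: (termP t) => _ /subsetP->.
rewrite inE -card_gt0 cards1 sub1set xG; split=> //.
  by apply/atom_ltP; exists x; rewrite ?set11.
by apply/atom_ltP => -[y /set1P->]; apply/negP.
Qed.

(** A crossed atom is a union of two atoms in [K], hence adds nothing new to [K], and its part [rho]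
    places it below [rR]. Conversely, an atom in [K] that satisfies the implication lies outside
    [H], so the crossing keeps it. *)
Lemma in_atoms_crossing C (rL rR : term C) (K : model C) phi :
  (phi \in atoms_in (crossing rL rR K)) =
  (phi \in atoms_in K) && (atom_lt phi rL ==> atom_lt phi rR).
Proof.
have crK := crossingP rL rR (atoms_in_atomizes K).
apply/idP/andP => [phiK|[phiK h]]; last first.
  apply: (subsetP (atomizes_sub crK)); rewrite !inE in phiK *.
  by rewrite phiK /= andbT negb_and negbK; move: h; rewrite implybE => ->.
have r := atomizes_refines (atoms_in_atomizes _) crK phiK.
have [phi0 phiC] := atoms_in_sub phiK; split.
  apply: (refines_atoms_in (atoms_in_atomizes K)) => // _ x /set1P-> xphi.
  have [psi + /andP[xpsi psiphi]] := r _ xphi.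
  rewrite in_setU => /orP[/setDP[psiK _]|/imset2P[lam rho]].
    by exists psi; rewrite ?xpsi.
  rewrite !in_set => /andP[lamK _] /andP[rhoK _] def; move: xpsi psiphi.
  rewrite {psi}def subUset in_setU => /orP[xl|xr] /andP[lphi rphi].
    by exists lam; rewrite ?in_set ?xl.
  by exists rho; rewrite ?in_set ?xr.
apply/implyP => /atom_ltP[x xphi xL].
have [psi + /andP[xpsi psiphi]] := r _ xphi.
rewrite in_setU => /orP[/setDP[psiK]|/imset2P[lam rho _]].
  rewrite in_set psiK /= negb_and negbK => /orP[/atom_ltP[]|]; first by exists x.
  exact: atom_lt_sub.
rewrite in_set => /andP[_ rhoR] def; apply: atom_lt_sub rhoR.
by apply: subset_trans psiphi; rewrite def subsetUr.
Qed.

(** Each crossing only filters the atoms in the model, so the conditions accumulate; the two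
    opposite crossings at [i] together impose an equivalence. *)
Lemma in_atoms_big_crossing C I (r : seq I) (l u : I -> term C) (K : model C) phi :
  (phi \in atoms_in ((\big[comp/id]_(i <- r)
     (crossing (l i) (u i) \o crossing (u i) (l i))) K)) =
  (phi \in atoms_in K) && all (fun i => atom_lt phi (l i) == atom_lt phi (u i)) r.
Proof.
elim: r => [|i r IH]; first by rewrite big_nil andbT.
rewrite big_cons /=; move: (bigop _ _ _ _) IH => f IH.
rewrite (in_atoms_crossing (l i) (u i)) (in_atoms_crossing (u i) (l i)) IH.
by do 2!case: (atom_lt phi _); rewrite /= ?andbT ?andbF.
Qed.

(** The singletons of constants of [G] are atoms, so the part of [phi] in [G] is unconstrained. By
    disjointness, a constant of [C] can only come from an atom in [M]. That [phi] meets [C] makes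
    [phi :&: C] nonempty, as an atom must be. *)
Lemma in_atoms_union_free C G (M : model C) phi :
    phi \subset C :|: G -> [disjoint C & G] -> atom_lt phi C ->
  (phi \in atoms_in (union_model M (free_model G))) = (phi :&: C \in atoms_in M).
Proof.
move=> phiCG dis phiC; have AM := atoms_in_atomizes M.
have UM := unionP AM (atoms_in_atomizes (free_model G)).
rewrite atoms_in_free in UM; apply/idP/idP => [phiU|phiM].
  apply: (refines_atoms_in AM) => //; first exact: subsetIr.
  move=> _ x /set1P-> /setIP[xphi xC].
  have [psi + /andP[xpsi psiphi]] :=
    atomizes_refines (atoms_in_atomizes _) UM phiU xphi.
  rewrite in_setU => /orP[psiM|]; last first.
    by rewrite inE => /andP[_ /subsetP/(_ _ xpsi)]; rewrite (disjointFr dis).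
  by exists psi; rewrite // xpsi subsetI psiphi; case: (atoms_in_sub psiM).
apply: (refines_atoms_in UM) => //.
  by case/atom_ltP: phiC => x xphi _; apply/set0Pn; exists x.
move=> _ x /set1P-> xphi.
have /setUP[xC|xG] := subsetP phiCG _ xphi.
  by exists (phi :&: C); [rewrite in_setU phiM | rewrite in_setI xphi xC subsetIl].
exists [set x]; last by rewrite set11 sub1set.
by rewrite in_setU [X in _ || X]inE -card_gt0 cards1 sub1set xG orbT.
Qed.

(** * Inequalities in a restricted model *)

Fact widen_term_subproof Q C (sQC : Q \subset C) (t : term Q) :
  (comps t != set0) && (comps t \subset C).
Proof. by case/andP: (termP t) => -> /subset_trans->. Qed.
Definition widen_term Q C (sQC : Q \subset C) (t : term Q) : term C :=
  Term (widen_term_subproof sQC t).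

Lemma nu_restrict_le Q C (sQC : Q \subset C) (M : model C) (t s : term Q) :
  (nu (restrict sQC M) t <= nu (restrict sQC M) s) =
  (nu M (widen_term sQC t) <= nu M (widen_term sQC s)).
Proof.
rewrite nu_submodel_le; set b := fun q => _.
suff ev u : eval b u = nu M (widen_term sQC u) by rewrite !ev.
(* The two elements are equal because they have the same upper bounds. *)
apply/eqP/eq_leP => y; rewrite !eval_le; apply/forallP/forallP => h x; last first.
  exact: h (widen_const sQC x).
apply/implyP => xu; have xQ : val x \in Q.
  by case/andP: (termP u) => _ /subsetP->.
have := implyP (h (exist _ (val x) xQ)) xu.
by rewrite /b (_ : widen_const _ _ = x) //; apply: val_inj.
Qed.

(** * Non-redundant atoms *)

Lemma nonredundant_sub C (M : model C) A :
  atomizes A M -> nonredundant_atoms M \subset A.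
Proof.
move=> AM; apply/subsetP => phi; rewrite inE => /andP[phiM].
case/forallPn=> x; rewrite negb_imply => /andP[xphi /existsPn nex].
(* At [x] no atom in [M] is properly contained in [phi], so the atom of [A] refining [phi] at [x]
   must be [phi] itself. *)
have [psi psiA /andP[xpsi psiphi]] :=
  atomizes_refines (atoms_in_atomizes M) AM phiM xphi.
have [<-//|neq] := eqVneq psi phi; have := nex psi.
by rewrite (subsetP (atomizes_sub AM)) // xpsi properEneq neq psiphi.
Qed.

(* A minimal atom of M containing x is not redundant, since redundancy at x   *)
(* would provide a smaller one.                                               *)
Lemma nonredundant_atomizes C (M : model C) : atomizes (nonredundant_atoms M) M.
Proof.
have AM := atoms_in_atomizes M.
have r1 : refines (atoms_in M) (nonredundant_atoms M).
  move=> phi x phiM xphi.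
  pose P psi := (psi \in atoms_in M) && (x \in psi).
  have Pphi : P phi by rewrite /P phiM.
  have [psi /minsetP[/andP[psiM xpsi] min] psiphi] := minset_exists Pphi.
  exists psi; rewrite ?xpsi // inE psiM; apply/forallPn; exists x.
  rewrite xpsi; apply/existsP => -[eta /and3P[etaM xeta etapsi]].
  have Peta : P eta by rewrite /P etaM.
  by move: (etapsi); rewrite (min _ Peta (proper_sub etapsi)) properxx.
have r2 : refines (nonredundant_atoms M) (atoms_in M).
  move=> phi x; rewrite inE => /andP[phiM _] xphi.
  by exists phi; rewrite ?xphi ?subxx.
case/and3P: (AM) => sA /forallP cA _; apply/and3P; split.
- by apply: subset_trans sA; apply: nonredundant_sub.
- apply/forallP => x; apply/implyP => /(implyP (cA x))/existsP[phi /andP[phiM xphi]].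
  have [psi psiM /andP[xpsi _]] := r1 _ _ phiM xphi.
  by apply/existsP; exists psi; rewrite psiM.
apply/forallP => t; apply/forallP => s; rewrite (atomizes_le _ _ AM).
by apply/eqP; congr (~~ _); apply/idP/idP; apply: refines_discriminates.
Qed.

Lemma card_rename_atoms m (c : 'I_m -> T) Gk A : (#|rename_atoms c Gk A| <= #|A|)%N.
Proof. exact: leq_trans (subset_leq_card (subsetDl _ _)) (leq_imset_card _ _). Qed.

End Atoms.

(** * Substituting the terms [t i] for the constants [g i] *)

Section Substitution.
Import Order.TTheory.
Local Open Scope order_scope.
Variables (T : finType) (e : nat) (C G : {set T}) (g : 'I_e -> T).
Hypothesis defG : G = [set g i | i : 'I_e].
Variable t : 'I_e -> term C.

Let g_in i : g i \in G. Proof. by rewrite defG imset_f. Qed.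

Let in_g x : x \in G -> exists i, x = g i.
Proof. by rewrite defG => /imsetP[i _ ->]; exists i. Qed.

Fact subst_term_subproof (u : term G) :
  (\bigcup_(i | g i \in comps u) comps (t i) != set0) &&
  (\bigcup_(i | g i \in comps u) comps (t i) \subset C).
Proof.
apply/andP; split; last first.
  by apply/bigcupsP => i _; case/andP: (termP (t i)).
have [[x xG] /= xu] := term_ex u.
have [i xg] := in_g xG.
have [z zt] := term_ex (t i); apply/set0Pn; exists (val z).
by apply/bigcupP; exists i; rewrite // -xg.
Qed.
Definition subst_term (u : term G) : term C := Term (subst_term_subproof u).

Lemma atom_lt_subst phi u : reflect
  (exists2 i, g i \in comps u & atom_lt phi (t i)) (atom_lt phi (subst_term u)).
Proof.
apply: (iffP (atom_ltP _ _)) => [[x xphi /bigcupP[i gu xt]]|].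
  by exists i => //; apply/atom_ltP; exists x.
case=> i gu /atom_ltP[x xphi xt]; exists x => //.
by apply/bigcupP; exists i.
Qed.

Lemma nu_subst (M : model C) (a : {x | x \in G} -> M)
    (a_g : forall i (x : {x | x \in G}), val x = g i -> a x = nu M (t i))
    (u : term G) :
  eval a u = nu M (subst_term u).
Proof.
apply/eqP/eq_leP => y; rewrite !eval_le; apply/forallP/forallP => h.
  move=> z; apply/implyP => /bigcupP[i gu zt].
  have := implyP (h (exist _ (g i) (g_in i))) gu.
  by rewrite (a_g i) // eval_le => /forallP/(_ z)/implyP; apply.
move=> x; apply/implyP => xu; have [i xg] := in_g (valP x).
rewrite (a_g i) // eval_le; apply/forallP => z; apply/implyP => zt.
by apply: (implyP (h z)); apply/bigcupP; exists i; rewrite // -xg.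
Qed.

Lemma nu_rename_le m (c : 'I_m -> T) (Gk : 'I_m -> {set T}) (M : model C)
    (defC : C = [set c k | k : 'I_m]) (sub : forall k, Gk k \subset G)
    (GkE : forall k i, (g i \in Gk k) = (c k \in comps (t i))) (u v : term G) :
  (nu (rename c Gk G M) u <= nu (rename c Gk G M) v) =
  (nu M (subst_term u) <= nu M (subst_term v)).
Proof.
rewrite nu_model_of_le (atomizes_le _ _ (atoms_in_atomizes M)); congr (~~ _).
have renE phi (w : term G) : phi \in atoms_in M ->
    atom_lt (\bigcup_(k | c k \in phi) Gk k) w = atom_lt phi (subst_term w).
  move=> /atoms_in_sub[_ /subsetP phiC].
  apply/atom_ltP/atom_lt_subst => [[x /bigcupP[k ck xk] xw]|[i gw]].
    have [i xg] := in_g (subsetP (sub k) _ xk).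
    exists i; rewrite -?xg //; apply/atom_ltP; exists (c k) => //.
    by rewrite -GkE -xg.
  case/atom_ltP=> x xphi xt.
  have /imsetP[k _ xc] : x \in [set c k | k : 'I_m] by rewrite -defC phiC.
  exists (g i) => //; apply/bigcupP; exists k.
    by rewrite -xc.
  by rewrite GkE -xc.
apply/discriminatesP/discriminatesP => -[phi [+ pu pv]].
  case/setD1P=> _ /imsetP[psi psiM def]; exists psi.
  by rewrite -!renE // -def.
move=> phiM; rewrite -renE // in pu; rewrite -renE // in pv.
exists (\bigcup_(k | c k \in phi) Gk k); split=> //.
(* Renaming discards empty images; this one is below [u], hence nonempty. *)
rewrite !inE imset_f // andbT; apply: contraTneq pu => ->.
by rewrite /atom_lt set0I eqxx.
Qed.

(** Cutting an atom down to [C], and extending an atom in [M] by the [g i] whose [t i] it is below,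
    carry violations of an inequality from one side to the other: on the atoms in [P], containing
    [g i] and being below [t i] are the same condition. *)
Lemma nu_crossings_le (M : model C) (g_inj : injective g) (disjCG : [disjoint C & G]) (u v : term G) :
  let P := (\big[comp/id]_(i < e)
              (crossing [set g i] (t i) \o crossing (t i) [set g i]))
             (union_model M (free_model G)) in
  (nu (restrict (subsetUr C G) P) u <= nu (restrict (subsetUr C G) P) v) =
  (nu M (subst_term u) <= nu M (subst_term v)).
Proof.
move=> P; rewrite nu_restrict_le (atomizes_le _ _ (atoms_in_atomizes M)).
rewrite (atomizes_le _ _ (atoms_in_atomizes P)) /=; congr (~~ _).
have gCG i : g i \in C :|: G by rewrite inE g_in orbT.
have inP phi : (phi \in atoms_in P) =
    (phi \in atoms_in (union_model M (free_model G))) &&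
    [forall i, (g i \in phi) == atom_lt phi (t i)].
  (* [crossing] takes bare sets of constants, while [in_atoms_big_crossing] needs terms over
     [C :|: G]. *)
  pose tg i := term_const (exist (fun x => x \in C :|: G) _ (gCG i)).
  pose tt i := widen_term (subsetUl C G) (t i).
  have := in_atoms_big_crossing (index_enum 'I_e) tg tt
    (union_model M (free_model G)) phi.
  rewrite -/P => ->; congr andb.
  have tgE i : atom_lt phi (tg i) = (g i \in phi) := atom_lt1 _ _.
  apply/allP/forallP => h i; last by move=> _; rewrite tgE; apply: h.
  by rewrite -tgE; apply/h/mem_index_enum.
have ltI phi i : atom_lt (phi :&: C) (t i) = atom_lt phi (t i).
  apply/idP/idP; first exact/atom_lt_sub/subsetIl.
  case/atom_ltP=> x xphi xt; apply/atom_ltP; exists x => //.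
  by rewrite inE xphi; case/andP: (termP (t i)) => _ /subsetP->.
have inG (w : term G) x : x \in comps w -> exists i, x = g i.
  by case/andP: (termP w) => _ /subsetP sub /sub /in_g.
apply/discriminatesP/discriminatesP => -[phi [phiM pu pv]].
  move: phiM; rewrite inP => /andP[phiU /forallP phig].
  have ltE (w : term G) : atom_lt phi w = atom_lt (phi :&: C) (subst_term w).
    apply/atom_ltP/atom_lt_subst => [[x xphi xw]|[i gw]].
      have [i xg] := inG _ _ xw; exists i; first by rewrite -xg.
      by rewrite ltI -(eqP (phig i)) -xg.
    by rewrite ltI -(eqP (phig i)) => gphi; exists (g i).
  exists (phi :&: C); rewrite -!ltE; split=> //.
  rewrite -(in_atoms_union_free (phi := phi) M _ disjCG) //.
    by case: (atoms_in_sub phiU).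
  (* An atom in [P] below a term over [G] contains some [g i], so it is below [t i] and meets
     [C]. *)
  move: pu; rewrite ltE => /atom_ltP[x /setIP[xphi xC] _].
  by apply/atom_ltP; exists x.
have [_ phiC] := atoms_in_sub phiM.
pose psi := phi :|: [set g i | i in [pred i | atom_lt phi (t i)]].
have psiC : psi :&: C = phi.
  apply/setP => x; rewrite !inE; have [xC|xC] := boolP (x \in C); last first.
    by rewrite andbF; apply/esym; apply: contraNF xC => /(subsetP phiC).
  rewrite andbT orb_idr // => /imsetP[i _ xg]; move: xC.
  by rewrite xg (disjointFl disjCG).
have psig i : (g i \in psi) = atom_lt psi (t i).
  rewrite -ltI psiC in_setU mem_imset // inE; case: (atom_lt phi (t i)).
    by rewrite orbT.
  by rewrite orbF; apply: contraFF (disjointFl disjCG (g_in i)) => /(subsetP phiC).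
have ltE (w : term G) : atom_lt psi w = atom_lt phi (subst_term w).
  rewrite -psiC; apply/atom_ltP/atom_lt_subst => [[x xpsi xw]|[i gw]].
    have [i xg] := inG _ _ xw; exists i; first by rewrite -xg.
    by rewrite ltI -psig -xg.
  by rewrite ltI -psig => gpsi; exists (g i).
exists psi; rewrite !ltE; split=> //; rewrite inP; apply/andP; split; last first.
  by apply/forallP => i; apply/eqP.
rewrite in_atoms_union_free ?psiC //.
  rewrite subUset (subset_trans phiC (subsetUl _ _)) /=.
  by apply/subsetP => _ /imsetP[i _ ->].
have [x xphi _] := atom_ltP _ _ pu; apply/atom_ltP; exists x.
  by rewrite inE xphi.
exact: (subsetP phiC).
Qed.
End Substitution.

Theorem theorem33 (T : finType) (m e : nat) (C G : {set T})
    (c : 'I_m -> T) (c_inj : injective c) (defC : C = [set c k | k : 'I_m])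
    (g : 'I_e -> T) (g_inj : injective g) (defG : G = [set g i | i : 'I_e])
    (disjGC : G :&: C = set0)
    (M : model C) (t : 'I_e -> term C)
    (a : {x | x \in G} -> M)
    (a_g : forall i (x : {x | x \in G}), val x = g i -> a x = nu M (t i)) :
  let S : model G := submodel a in
  [/\ model_eq S
        (restrict (subsetUr C G)
          ((\big[comp/id]_(i < e)
              (crossing [set g i] (t i) \o
               crossing (t i) [set g i]))
             (union_model M (free_model G)))),
      forall Gk : 'I_m -> {set T},
        (forall k, Gk k \subset G) ->
        (forall k i, (g i \in Gk k) = (c k \in comps (t i))) ->
        model_eq S (rename c Gk G M)
    & #|nonredundant_atoms S| <= #|nonredundant_atoms M| ].
Proof.
move=> S.
have S_le u v : (nu S u <= nu S v)%O =
    (nu M (subst_term defG t u) <= nu M (subst_term defG t v))%O.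
  by rewrite nu_submodel_le !(nu_subst defG a_g).
have renS (Gk : 'I_m -> {set T}) : (forall k, Gk k \subset G) ->
    (forall k i, (g i \in Gk k) = (c k \in comps (t i))) ->
    model_eq S (rename c Gk G M).
  by move=> sub GkE u v; rewrite S_le (nu_rename_le defG M defC sub GkE).
split=> //.
  move=> u v; rewrite S_le nu_crossings_le //.
  by rewrite -setI_eq0 setIC disjGC.
pose Gk k := [set g i | i in [pred i | c k \in comps (t i)]].
have GkG k : Gk k \subset G.
  by rewrite defG; apply/subsetP => _ /imsetP[i _ ->]; rewrite imset_f.
have GkE k i : (g i \in Gk k) = (c k \in comps (t i)) by rewrite mem_imset.
(* Terms are nonempty, so every [g i] lies in some [Gk k]; [renameP] needs this for the renamed
   atoms to cover [G]. *)
have defGk : \bigcup_k Gk k = G.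
  apply/eqP; rewrite eqEsubset; apply/andP; split; first exact/bigcupsP.
  rewrite {1}defG; apply/subsetP => _ /imsetP[i _ ->].
  have [x xt] := term_ex (t i).
  have /imsetP[k _ xc] : val x \in [set c k | k : 'I_m] by rewrite -defC (valP x).
  by apply/bigcupP; exists k; rewrite // GkE -xc.
have cC k : c k \in C by rewrite defC imset_f.
(* The renamed non-redundant atoms of [M] atomize [S], so they include all its non-redundant atoms,
   and renaming cannot increase their number. *)
have renM := renameP cC defGk (nonredundant_atomizes M).
have := nonredundant_sub (atomizes_eq (renS Gk GkG GkE) renM).
by move=> /subset_leq_card/leq_trans; apply; apply: card_rename_atoms.
Qed.
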